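(* None of the following inclusions holds in general; that is, for each of (i), (ii), (iii) there exist problem data $(X,g,q,W,T,h)$ satisfying the standing assumptions, a subset $\hat V\subseteq V(\Pi)$ and $\tau\in\mathbb{R}$ for which it fails: (i) $L^{BM}_{\hat V}(\tau)\subseteq L^{EV}(\tau)$; (ii) $\operatorname{proj}_x\big(L^{BM}_{\hat V}(\tau)\big)\subseteq L^{PV}(\tau)$; (iii) $\operatorname{proj}_x\big(L^{BM}_{\hat V}(\tau)\big)\subseteq \operatorname{proj}_x\big(L^{EF}(\tau)\big)$.
   Context: Setting. Problem data: $X\subseteq\mathbb{R}^{n_1}$, $g:X\to\mathbb{R}$, $q\in\mathbb{R}^{n_2}$, $W\in\mathbb{R}^{n_3\times n_2}$, $T\in\mathbb{R}^{n_3\times n_1}$, $h\in\mathbb{R}^{n_3}$. For $x\in X$ put $Y(x)=\{y\in\mathbb{R}^{n_2}_+ : Wy+Tx=h\}$, and $\Gamma=\{(x,y)\in\mathbb{R}^{n_1}\times\mathbb{R}^{n_2}_+ : x\in X,\ Wy+Tx=h\}$. The extensive form problem is $\min\{g(x)+q^Ty : (x,y)\in\Gamma\}$. Let $\Pi=\{\pi\in\mathbb{R}^{n_3} : \pi^TW\le q^T\}$ (componentwise) and let $V(\Pi)$ be its set of vertices. The value function is $Q(x)=\min\{q^Ty : y\in Y(x)\}$ for $x\in X$. Standing assumptions: (relatively complete recourse) for every $x\in X$ there is $y\in Y(x)$ with $q^Ty<\infty$; (dual non-emptiness) $\Pi\ne\varnothing$; (existence of a minimizer) there is an optimal $(x^*,y^*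 )\in\Gamma$ for the extensive form problem; (finite solution) $z^*=g(x^* )+q^Ty^*>-\infty$. Under these assumptions the paper represents the value function through the dual vertices: $Q(x)=\max_{\pi\in V(\Pi)}\pi^T(h-Tx)$ for all $x\in X$ (in particular $V(\Pi)\neq\varnothing$). Epigraphs: $\operatorname{epi}(Q)=\{(x,\theta)\in X\times\mathbb{R} : \theta\ge\pi^T(h-Tx)\ \ \forall\pi\in V(\Pi)\}$ and, for $\hat V\subseteq V(\Pi)$, $\operatorname{epi}(\hat Q_{\hat V})=\{(x,\theta)\in X\times\mathbb{R} : \theta\ge\pi^T(h-Tx)\ \ \forall\pi\in\hat V\}$. Sublevel sets: $L^{EF}(\tau)=\{(x,y)\in\Gamma : g(x)+q^Ty\le\tau\}$; $L^{PV}(\tau)=\{x\in X : g(x)+Q(x)\le\tau\}$; $L^{EV}(\tau)=\{(x,\theta)\in\operatorname{epi}(Q) : g(x)+\theta\le\tau\}$; $L^{BM}_{\hat V}(\tau)=\{(x,\theta)\in\operatorname{epi}(\hat Q_{\hat V}) : g(x)+\theta\le\tau\}$. The operator $\operatorname{proj}_x$ is the projection onto the first $n_1$ coordinates (the $x$ variables), applied to sets elementwise. *)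

(* Defs.v *)
From mathcomp Require Import all_boot all_order all_algebra.
From mathcomp Require Import all_classical all_reals all_analysis.

Set Implicit Arguments.
Unset Strict Implicit.
Unset Printing Implicit Defensive.

Import Order.TTheory GRing.Theory Num.Theory.

Local Open Scope classical_set_scope.
Local Open Scope ring_scope.

Section Vectors.
Context {R : realType}.

Definition dot n (u v : 'cV[R]_n) : R := (u^T *m v) 0 0.

Definition nonneg n (y : 'cV[R]_n) : Prop := forall j, 0 <= y j 0.

(* Vertices of a polyhedron, as its extreme points. *)
Definition vertices n (S : set 'cV[R]_n) : set 'cV[R]_n :=
  [set p | S p /\ forall (u v : 'cV[R]_n) (t : R), S u -> S v ->
                    0 < t < 1 -> p = t *: u + (1 - t) *: v -> u = v].

End Vectors.

(* g is total; only its values on X are ever used. *)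
Record problem (R : realType) (n1 n2 n3 : nat) := Problem {
  X : set 'cV[R]_n1;
  g : 'cV[R]_n1 -> R;
  q : 'cV[R]_n2;
  W : 'M[R]_(n3, n2);
  T : 'M[R]_(n3, n1);
  h : 'cV[R]_n3 }.

Section Benders.
Context {R : realType} {n1 n2 n3 : nat}.
Variable P : problem R n1 n2 n3.

Definition Y (x : 'cV[R]_n1) : set 'cV[R]_n2 :=
  [set y | nonneg y /\ W P *m y + T P *m x = h P].

Definition Gamma : set ('cV[R]_n1 * 'cV[R]_n2) :=
  [set p | X P p.1 /\ Y p.1 p.2].

Definition objective (p : 'cV[R]_n1 * 'cV[R]_n2) : R :=
  g P p.1 + dot (q P) p.2.

Definition Pi : set 'cV[R]_n3 :=
  [set pi | forall j, (pi^T *m W P) 0 j <= (q P)^T 0 j].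

Definition V : set 'cV[R]_n3 := vertices Pi.

(* The minimum of q^T y over Y x, totalized as an infimum in the extended
   reals; see Q_min. *)
Definition Q (x : 'cV[R]_n1) : \bar R :=
  ereal_inf [set (dot (q P) y)%:E | y in Y x].

Lemma Q_min x y : Y x y -> (forall y', Y x y' -> dot (q P) y <= dot (q P) y') ->
  Q x = (dot (q P) y)%:E.
Proof.
move=> Yy miny; apply/eqP; rewrite eq_le; apply/andP; split.
  by apply: ereal_inf_lbound; exists y.
by apply: le_ereal_inf_tmp => _ [y' Yy' <-]; rewrite lee_fin; exact: miny.
Qed.

Definition cut (pi : 'cV[R]_n3) (x : 'cV[R]_n1) : R :=
  dot pi (h P - T P *m x).

Definition complete_recourse : Prop :=
  forall x, X P x -> exists2 y, Y x y & ((dot (q P) y)%:E < +oo)%E.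

(* Existence of a minimizer, together with z^* > -oo; the latter, like the
   bound < +oo above, is automatic for real data. *)
Definition finite_minimizer : Prop :=
  exists p, [/\ Gamma p, forall p', Gamma p' -> objective p <= objective p'
              & (-oo < (objective p)%:E)%E].

(* Q x = max over pi in V of pi^T (h - T x), the maximum being attained. This
   does not follow from the other assumptions when Pi contains a line (then V
   is empty), so it is a separate requirement. *)
Definition dual_representation : Prop :=
  forall x, X P x -> exists pi,
    [/\ V pi, Q x = (cut pi x)%:E & forall pi', V pi' -> cut pi' x <= cut pi x].

Definition standing_assumptions : Prop :=
  [/\ complete_recourse, Pi !=set0, finite_minimizer & dual_representation].

(* epi V is the epigraph of Q on X, and epi Vhat that of its relaxation. *)
Definition epi (U : set 'cV[R]_n3) : set ('cV[R]_n1 * R) :=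
  [set p | X P p.1 /\ forall pi, U pi -> cut pi p.1 <= p.2].

Definition L_EF (tau : R) : set ('cV[R]_n1 * 'cV[R]_n2) :=
  [set p | Gamma p /\ objective p <= tau].

Definition L_PV (tau : R) : set 'cV[R]_n1 :=
  [set x | X P x /\ ((g P x)%:E + Q x <= tau%:E)%E].

Definition L_EV (tau : R) : set ('cV[R]_n1 * R) :=
  [set p | epi V p /\ g P p.1 + p.2 <= tau].

Definition L_BM (Vhat : set 'cV[R]_n3) (tau : R) : set ('cV[R]_n1 * R) :=
  [set p | epi Vhat p /\ g P p.1 + p.2 <= tau].

End Benders.

Definition proj_x {A B : Type} (S : set (A * B)) : set A := fst @` S.

(* Main.v *)
Require Import Defs.
From mathcomp Require Import all_boot all_order all_algebra.
From mathcomp Require Import all_classical all_reals all_analysis.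
From mathcomp Require Import lra.

(** Dropping all the cuts leaves the relaxation with no lower bound on theta.
    With W = h = q = 1 and T = 0 in dimension one, Y(x) = {1}, so Q is
    constantly 1 and the only dual vertex is 1.  For g = 0 and tau = 0 the true
    sublevel sets are empty, whereas L^BM of the empty set of cuts contains
    (0, 0). *)

Import Order.TTheory GRing.Theory Num.Theory.

Local Open Scope classical_set_scope.
Local Open Scope ring_scope.

Lemma dot_cV1 (R : realType) (u v : 'cV[R]_1) : dot u v = u 0 0 * v 0 0.
Proof. by rewrite /dot mxE big_ord1 mxE. Qed.

Definition unit_problem (R : realType) : problem R 1 1 1 :=
  {| X := setT; g := fun=> 0; q := const_mx 1;
     W := 1%:M; T := 0; h := const_mx 1 |}.

Section UnitProblem.
Variable R : realType.
Local Notation P := (unit_problem R).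

Lemma unit_YE (x y : 'cV[R]_1) : Y P x y <-> y = const_mx 1.
Proof.
rewrite /Y /= mul1mx mul0mx addr0; split=> [[]//|->]; split=> // j.
by rewrite mxE ler01.
Qed.

Lemma unit_dot_q {x y : 'cV[R]_1} : Y P x y -> dot (q P) y = 1.
Proof. by move=> /unit_YE ->; rewrite dot_cV1 !mxE mulr1. Qed.

Lemma unit_PiE (pi : 'cV[R]_1) : Pi P pi <-> pi 0 0 <= 1.
Proof.
rewrite /Pi /= mulmx1; split=> [/(_ 0)|pi1 j]; first by rewrite !mxE.
by rewrite ord1 !mxE.
Qed.

Lemma unit_cut (pi x : 'cV[R]_1) : Defs.cut P pi x = pi 0 0.
Proof. by rewrite /Defs.cut /= mul0mx subr0 dot_cV1 mxE mulr1. Qed.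

(** [Pi] is the half-line of numbers at most 1, and an average of two such numbers with positive
    weights reaches the endpoint 1 only if both do. *)
Lemma unit_V1 : V P (const_mx 1).
Proof.
split=> [|u v t /unit_PiE u1 /unit_PiE v1 /andP[t0 t1] /matrixP/(_ 0 0)].
  by apply/unit_PiE; rewrite mxE.
rewrite !mxE => E; apply/matrixP => i j; rewrite !ord1.
(* [E] says that the weighted slacks [t * (1 - u 0 0)] and [(1 - t) * (1 - v 0 0)] sum to 0; being
   nonnegative, both vanish. *)
have tu : 0 <= t * (1 - u 0 0) by rewrite mulr_ge0 ?subr_ge0 // ltW.
have tv : 0 <= (1 - t) * (1 - v 0 0) by rewrite mulr_ge0 ?subr_ge0 // ltW.
have /eqP : t * (1 - u 0 0) = 0 by lra.
have /eqP : (1 - t) * (1 - v 0 0) = 0 by lra.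
(* Neither weight is 0, so the slacks themselves are. *)
rewrite !mulf_eq0 (gt_eqF t0) subr_eq0 (gt_eqF t1) /= !subr_eq0.
by move=> /eqP <- /eqP <-.
Qed.

Lemma unit_Q (x : 'cV[R]_1) : Q P x = 1%:E.
Proof.
have Y1 : Y P x (const_mx 1) by apply/unit_YE.
by rewrite (Q_min Y1) => [|y /unit_dot_q ->]; rewrite (unit_dot_q Y1).
Qed.

Lemma unit_standing_assumptions : standing_assumptions P.
Proof.
have Y1 x : Y P x (const_mx 1) by apply/unit_YE.
split.
- by move=> x _; exists (const_mx 1); rewrite ?ltry.
- by exists (const_mx 1); case: unit_V1.
(* The objective is constantly 1 on [Gamma], so any feasible pair is a minimizer. *)
- exists (0, const_mx 1); split; rewrite ?ltNyr// => -[x y] [_ /= Yy].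
  by rewrite /objective /= (unit_dot_q Yy) (unit_dot_q (Y1 0)).
(* Since T = 0, cuts do not depend on x, and the vertex 1 attains the maximum everywhere. *)
- move=> x _; exists (const_mx 1); split; first exact: unit_V1.
    by rewrite unit_Q unit_cut mxE.
  by move=> pi [/unit_PiE pi1 _]; rewrite !unit_cut [leRHS]mxE.
Qed.

Lemma unit_L_BM0 : L_BM P set0 0 (0, 0).
Proof. by split; rewrite //= addr0. Qed.

(** The cut of the vertex 1 forces theta to be at least 1, above the level 0. *)
Lemma unit_L_EV0 : L_EV P 0 = set0.
Proof.
apply/seteqP; split=> // -[x th] [[_ /(_ _ unit_V1)]] /=.
by rewrite unit_cut mxE; lra.
Qed.

Lemma unit_L_PV0 : L_PV P 0 = set0.
Proof.
by apply/seteqP; split=> // x [_]; rewrite unit_Q lee_fin /=; lra.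
Qed.

Lemma unit_L_EF0 : L_EF P 0 = set0.
Proof.
apply/seteqP; split=> // -[x y] [[_ /= Yy]].
by rewrite /objective /= (unit_dot_q Yy); lra.
Qed.

End UnitProblem.

Theorem mainTheorem2 (R : realType) :
  [/\ exists (n1 n2 n3 : nat) (P : problem R n1 n2 n3)
             (Vhat : set 'cV[R]_n3) (tau : R),
        [/\ [/\ (0 < n1)%N, (0 < n2)%N & (0 < n3)%N],
            standing_assumptions P, Vhat `<=` V P &
            ~ (L_BM P Vhat tau `<=` L_EV P tau)],
      exists (n1 n2 n3 : nat) (P : problem R n1 n2 n3)
             (Vhat : set 'cV[R]_n3) (tau : R),
        [/\ [/\ (0 < n1)%N, (0 < n2)%N & (0 < n3)%N],
            standing_assumptions P, Vhat `<=` V P &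
            ~ (proj_x (L_BM P Vhat tau) `<=` L_PV P tau)] &
      exists (n1 n2 n3 : nat) (P : problem R n1 n2 n3)
             (Vhat : set 'cV[R]_n3) (tau : R),
        [/\ [/\ (0 < n1)%N, (0 < n2)%N & (0 < n3)%N],
            standing_assumptions P, Vhat `<=` V P &
            ~ (proj_x (L_BM P Vhat tau) `<=` proj_x (L_EF P tau))]].
Proof.
(* The point x = 0 refutes both projected inclusions; the unprojected one is refuted by (0, 0)
   itself. *)
have BM0 : proj_x (L_BM (unit_problem R) set0 0) 0.
  by exists (0, 0) => //; exact: unit_L_BM0.
have std := unit_standing_assumptions R.
split; exists 1, 1, 1, (unit_problem R), set0, 0; split=> //.
- by rewrite unit_L_EV0 => /(_ _ (unit_L_BM0 R)).
- by rewrite unit_L_PV0 => /(_ _ BM0).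
(* A point in the projection of the empty set would have a preimage there. *)
- by rewrite unit_L_EF0 => /(_ _ BM0) [].
Qed.
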